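(* For any $d\ge 1$, any $1\le q\le\infty$, any $1\le p<\infty$, any width $H$, any $\psi,\mu\ge 0$ and any set $\mathcal S=\{x_1,\dots,x_m\}\subseteq\mathbb R^{n}$, $$\mathcal R_m(\mathcal F^{d,H}_{\psi_{p,q}\le\psi})\le \psi\left(2H^{[\frac1{p^*}-\frac1q]_+}\right)^{d-1}\mathcal R^{\mathrm{linear}}_{m,p,n}\le\sqrt{\frac{\psi^2\left(2H^{[\frac1{p^*}-\frac1q]_+}\right)^{2(d-1)}\min\{p^*,4\log(2n)\}\max_i\|x_i\|_{p^*}^2}{m}}$$ and so $$\mathcal R_m(\mathcal F^{d,H}_{\mu_{p,q}\le\mu})\le \mu^{d}\left(2H^{[\frac1{p^*}-\frac1q]_+}/\sqrt[q]{d}\right)^{d-1}\mathcal R^{\mathrm{linear}}_{m,p,n}\le\sqrt{\frac{\mu^{2d}\left(2H^{[\frac1{p^*}-\frac1q]_+}/\sqrt[q]{d}\right)^{2(d-1)}\min\{p^*,4\log(2n)\}\max_i\|x_i\|_{p^*}^2}{m}},$$ where in both lines the second inequality is asserted only if $1\le p\le 2$, and $p^*$ is defined by $\frac1{p^*}+\frac1p=1$.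
   Context: Let $\sigma(z)=\max(z,0)$ (ReLU), applied entrywise. $\mathcal F^{d,H}$ is the class of functions $f_w:\mathbb R^n\to\mathbb R$ computed by depth-$d$, width-$H$ fully connected networks with a single output, $f_w(x)=W^d\sigma(W^{d-1}\sigma(\cdots\sigma(W^1x)))$, with $W^1\in\mathbb R^{H\times n}$, $W^k\in\mathbb R^{H\times H}$ for $1<k<d$, $W^d\in\mathbb R^{1\times H}$ (if $d=1$, $f_w(x)=W^1x$ with $W^1\in\mathbb R^{1\times n}$); $w=(W^1,\dots,W^d)$. For a matrix $W$, $\|W\|_{p,q}=\big(\sum_i(\sum_j|W[i,j]|^p)^{q/p}\big)^{1/q}$, with the usual convention (max) for $q=\infty$, and $1/\infty=0$. Define $\mu_{p,q}(w)=\big(\sum_{k=1}^d\|W^k\|_{p,q}^q\big)^{1/q}$ and $\psi_{p,q}(w)=\prod_{k=1}^d\|W^k\|_{p,q}$. For a function $f\in\mathcal F^{d,H}$ let $\mu^{d,H}_{p,q}(f)=\inf_{f_w=f}\mu_{p,q}(w)$ and $\psi^{d,H}_{p,q}(f)=\inf_{f_w=f}\psi_{p,q}(w)$, and let $\mathcal F^{d,H}_{\psi_{p,q}\le\psi}=\{f\in\mathcal F^{d,H}:\psi^{d,H}_{p,q}(f)\le\psi\}$, $\mathcal F^{d,H}_{\mu_{p,q}\le\mu}=\{f\in\mathcal F^{d,H}:\mu^{d,H}_{p,q}(f)\le\mu\}$. The empirical Rademacher complexity with respect to $\mathcal S$ is $\mathcal R_m(\mathcal F)=\mathbb E_{\xi}\big[\frac1m\sup_{f\in\mathcal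 F}|\sum_{i=1}^m\xi_if(x_i)|\big]$ with $\xi$ uniform on $\{\pm1\}^m$. $\mathcal R^{\mathrm{linear}}_{m,p,n}$ is the Rademacher complexity with respect to $\mathcal S$ of the class $\{x\mapsto\langle v,x\rangle: v\in\mathbb R^n,\ \|v\|_p\le1\}$. $[a]_+=\max(a,0)$. *)

(* Defs.v *)
From HB Require Import structures.
From mathcomp Require Import all_boot all_order all_algebra.
From mathcomp Require Import all_classical all_reals all_analysis.

Set Implicit Arguments.
Unset Strict Implicit.
Unset Printing Implicit Defensive.

Import Order.TTheory GRing.Theory Num.Theory.
Import numFieldNormedType.Exports.

Local Open Scope classical_set_scope.
Local Open Scope ring_scope.

Section Norms.
Context {R : realType}.

(* The case r = -oo is a junk value; only exponents r >= 1 are meant. *)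
Definition lnorm (r : \bar R) (k : nat) (u : 'I_k -> R) : R :=
  match r with
  | r%:E => (\sum_(i < k) `|u i| `^ r) `^ r^-1
  | +oo%E => \big[Num.max/0]_(i < k) `|u i|
  | -oo%E => 0
  end.

Definition vnorm (r : \bar R) (n : nat) (v : 'cV[R]_n) : R :=
  lnorm r (fun j => v j 0).

Definition mxnorm (p q : \bar R) (m n : nat) (W : 'M[R]_(m, n)) : R :=
  lnorm q (fun i => lnorm p (fun j => W i j)).

(* 1/r as a real number, with 1/+oo = 0. *)
Definition rinv (r : \bar R) : R := fine r^-1%E.

End Norms.

Section Networks.
Context {R : realType}.
Variables n H : nat.

Definition relu (k : nat) (v : 'cV[R]_k) : 'cV[R]_k :=
  map_mx (fun z => Num.max z 0) v.

(* Number of units feeding the layer that follows k hidden layers. *)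
Definition fan_in (k : nat) : nat := if k is 0 then n else H.

(* Weights (W^1, ..., W^k) of the first k hidden layers, the last one
   outermost: ((tt, W^1), ..., W^k). *)
Fixpoint hidden (k : nat) : Type :=
  if k is k'.+1 then (hidden k' * 'M[R]_(H, fan_in k'))%type else unit.

(* A network of depth d >= 1 has d - 1 hidden layers and one output row. *)
Definition network (d : nat) : Type :=
  (hidden d.-1 * 'M[R]_(1, fan_in d.-1))%type.

Fixpoint activation (k : nat) : hidden k -> 'cV[R]_n -> 'cV[R]_(fan_in k) :=
  match k with
  | 0 => fun _ x => x
  | k'.+1 => fun w x => relu (w.2 *m activation w.1 x)
  end.

Definition netfun (d : nat) (w : network d) (x : 'cV[R]_n) : R :=
  (w.2 *m activation w.1 x) 0 0.

Fixpoint hidden_norms (p q : \bar R) (k : nat) : hidden k -> seq R :=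
  match k with
  | 0 => fun _ => [::]
  | k'.+1 => fun w => rcons (hidden_norms p q w.1) (mxnorm p q w.2)
  end.

(* For d >= 1, [layer_norms p q w] lists the d norms of W^1, ..., W^d, so that
   its entry of index k < d is the norm of W^(k+1). *)
Definition layer_norms (p q : \bar R) (d : nat) (w : network d) : seq R :=
  rcons (hidden_norms p q w.1) (mxnorm p q w.2).

Definition mu_w (p q : \bar R) (d : nat) (w : network d) : R :=
  lnorm q (fun k : 'I_d => (layer_norms p q w)`_k).

Definition psi_w (p q : \bar R) (d : nat) (w : network d) : R :=
  \prod_(k < d) (layer_norms p q w)`_k.

Definition netclass (d : nat) : set ('cV[R]_n -> R) :=
  [set f | exists w : network d, netfun w = f].

(* The infima below range over nonempty sets of nonnegative reals as soon as f
   belongs to [netclass d]. *)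
Definition mu_f (p q : \bar R) (d : nat) (f : 'cV[R]_n -> R) : R :=
  inf [set mu_w p q w | w in [set w : network d | netfun w = f]].

Definition psi_f (p q : \bar R) (d : nat) (f : 'cV[R]_n -> R) : R :=
  inf [set psi_w p q w | w in [set w : network d | netfun w = f]].

Definition netclass_mu (p q : \bar R) (d : nat) (mu : R) :
    set ('cV[R]_n -> R) :=
  [set f | netclass d f /\ mu_f p q d f <= mu].

Definition netclass_psi (p q : \bar R) (d : nat) (psi : R) :
    set ('cV[R]_n -> R) :=
  [set f | netclass d f /\ psi_f p q d f <= psi].

End Networks.

Section Rademacher.
Context {R : realType}.

(* The supremum is taken in the extended reals, so that a class that is
   unbounded on the sample has infinite complexity. *)
Definition rademacher (n m : nat) (S : 'I_m -> 'cV[R]_n)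
    (F : set ('cV[R]_n -> R)) : \bar R :=
  (((2 ^ m)%:R^-1)%:E * \sum_(xi : {ffun 'I_m -> bool})
    ((m%:R^-1)%:E *
     ereal_sup [set (`|\sum_(i < m) (-1) ^+ xi i * f (S i)|)%:E | f in F]))%E.

Definition linclass (p : \bar R) (n : nat) : set ('cV[R]_n -> R) :=
  [set (fun x : 'cV[R]_n => \sum_(j < n) v j 0 * x j 0) |
     v in [set v : 'cV[R]_n | vnorm p v <= 1]].

Definition rademacher_linear (p : \bar R) (n m : nat) (S : 'I_m -> 'cV[R]_n) :
    \bar R :=
  rademacher S (linclass (n := n) p).

End Rademacher.

(* Main.v *)
Require Import Defs.
From HB Require Import structures.
From mathcomp Require Import all_boot all_order all_algebra.
From mathcomp Require Import all_classical all_reals all_analysis.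
From mathcomp Require Import ring lra.
Import Order.TTheory GRing.Theory Num.Theory.
Import numFieldNormedType.Exports.
Local Open Scope classical_set_scope.
Local Open Scope ring_scope.

(** Write [s] for the exponent conjugate to [p].  Every supremum inside the
    expectation over signs is replaced by a selector: a choice, for each sign vector,
    of an element of the class.  A network is positively homogeneous in each layer, so
    it equals its [psi] times a network all of whose layer norms are at most 1.  For
    those, Hoelder on the output row together with [|r|_s <= H^[1/s - 1/q]_+ |r|_q]
    reduces depth [d] to a single [relu] unit fed by a network of depth [d - 1], and
    the contraction principle (factor 2 because of the absolute value) removes the
    [relu]; iterating gives the factor [(2 H^[1/s - 1/q]_+)^(d-1)].  AM-GM bounds
    [psi] by [(mu / d^(1/q))^d], which turns the [psi] statement into the [mu]
    statement.  The linear class has complexity at most [E |sum_i xi_i x_i|_s / m];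
    writing each coordinate as its standard deviation times a normalised Rademacher
    sum, Khintchine's inequality gives the constant [s] and Massart's maximal
    inequality the constant [4 log (2n)]. *)

(** * Scalar inequalities: Bernoulli, power means and the hyperbolic cosine *)

Section Inequalities.
Context {R : realType}.
Implicit Types (r t l : R).

(** Bernoulli's inequality for real exponents: Young's inequality for the product [t * 1],
    multiplied by [r]. *)
Lemma powR_tangent r t : 1 <= r -> 0 <= t -> 1 + r * (t - 1) <= t `^ r.
Proof.
move=> r1 t0; have [->|rn1] := eqVneq r 1; first by rewrite powRr1//; lra.
have {}r1 : 1 < r by rewrite lt_neqAle eq_sym rn1.
have r0 : 0 < r by lra.
have s0 : 0 < (1 - r^-1)^-1 by rewrite invr_gt0 subr_gt0 invf_lt1.
have := @conjugate_powR R t 1 r _ t0 ler01 r0 s0.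
rewrite invrK powR1 mulr1 mul1r => /(_ ltac:(lra)).
rewrite -(ler_pM2l r0) mulrDr mulrC mulrCA divff ?gt_eqF// mulrBr divff ?gt_eqF//.
lra.
Qed.

(** Jensen's inequality for [t ^ r]: the tangent bounds at the mean [A] are added up, and their
    linear terms [y i / A - 1] sum to zero. *)
Lemma power_mean (I : finType) (y : I -> R) r : 1 <= r ->
  (forall i, 0 <= y i) ->
  ((\sum_i y i) / #|I|%:R) `^ r <= (\sum_i y i `^ r) / #|I|%:R.
Proof.
move=> r1 y0; set N : R := #|I|%:R; set A := _ / N.
have r0 : r != 0 by rewrite gt_eqF//; lra.
have N0 : 0 <= N by rewrite ler0n.
have A0 : 0 <= A by rewrite divr_ge0// sumr_ge0.
have S0 : 0 <= (\sum_i y i `^ r) / N.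
  by rewrite divr_ge0// sumr_ge0// => i _; rewrite powR_ge0.
have [AE|An0] := eqVneq A 0; first by rewrite AE powR0.
have Ap : 0 < A by rewrite lt0r An0.
have Np : 0 < N.
  by rewrite lt0r N0 andbT; apply: contra_neq An0 => NE; rewrite /A NE invr0 mulr0.
rewrite ler_pdivlMr//.
have -> : A `^ r * N = \sum_i A `^ r * (1 + r * (y i / A - 1)).
  rewrite -mulr_sumr big_split/= sumr_const -mulr_sumr sumrB sumr_const.
  rewrite -mulr_suml -[1 *+ _]/N.
  have -> : \sum_i y i = A * N by rewrite divfK// gt_eqF.
  by field.
apply: ler_sum => i _.
have -> : y i `^ r = A `^ r * (y i / A) `^ r.
  by rewrite -powRM ?A0 ?(divr_ge0 (y0 i) A0)// mulrCA divff// mulr1.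
by rewrite ler_wpM2l ?powR_ge0// powR_tangent// (divr_ge0 (y0 i) A0).
Qed.

(** This is [tanh t <= t] with denominators cleared; it gives the sign of the derivative in
    [expR_cosh_le]. *)
Lemma expR_tanh_le t : 0 <= t -> expR t - expR (- t) <= t * (expR t + expR (- t)).
Proof.
move=> t0.
pose f (x : R) : R := expR x - expR (- x) - x * (expR x + expR (- x)).
have df (x : R) : is_derive x (1 : R) f (- x * (expR x - expR (- x))).
  rewrite /f; apply: is_derive_eq.
  rewrite !scaler1 ?mulr_algl /= ?scalerN ?scaler1 /GRing.scale/=.
  ring.
suff : f t <= f 0 by rewrite {2}/f oppr0; rewrite /f; lra.
apply: (@ler0_derive1_nincry R f 0) => //.
- move=> x; rewrite in_itv/= andbT => x0; rewrite derive1E derive_val.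
  have : expR (- x) <= expR x by rewrite ler_expR; lra.
  by move=> h; rewrite mulNr oppr_le0 mulr_ge0 ?subr_ge0// ltW.
- by apply: continuous_subspaceT => x; apply/differentiable_continuous/derivable1_diffP.
Qed.

(** A random sign is sub-Gaussian: the quotient of the two sides is nonincreasing for [t >= 0],
    because [tanh t <= t]. *)
Lemma expR_cosh_le t : (expR t + expR (- t)) / 2 <= expR (t ^+ 2 / 2).
Proof.
wlog t0 : t / 0 <= t.
  move=> h; have [|tn] := leP 0 t; first exact: h.
  by have := h (- t); rewrite opprK sqrrN addrC; apply; lra.
pose f (x : R) : R := expR (- (x ^+ 2 / 2)) * (expR x + expR (- x)).
have df (x : R) : is_derive x (1 : R) f
   (expR (- (x ^+ 2 / 2)) * (expR x - expR (- x) - x * (expR x + expR (- x)))).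
  rewrite /f; apply: is_derive_eq.
  rewrite !scaler1 ?mulr_algl /= ?scalerN ?scaler1 /GRing.scale/=.
  by rewrite !mulr0 add0r; field.
have : f t <= f 0.
  apply: (@ler0_derive1_nincry R f 0) => //.
  - move=> z; rewrite in_itv/= andbT => z0; rewrite derive1E derive_val.
    rewrite mulr_ge0_le0 ?expR_ge0// subr_le0 expR_tanh_le//; exact: ltW.
  - by apply: continuous_subspaceT => x; apply/differentiable_continuous/derivable1_diffP.
rewrite /f expRN mulrC ler_pdivrMr ?expR_gt0//.
rewrite expr0n/= mul0r oppr0 expR0 mul1r; lra.
Qed.

End Inequalities.

(** * Vector norms with finite or infinite exponent, and their comparison *)

Section LNorm.
Context {R : realType}.
Implicit Types (r q : \bar R) (k : nat).

Lemma lnorm_ge0 r k (u : 'I_k -> R) : 0 <= lnorm r u.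
Proof.
case: r => [r| |]//=; first exact: powR_ge0.
by elim/big_ind: _ => // a b a0 b0; rewrite le_max a0.
Qed.

Lemma lnorm_powR (r : R) k (u : 'I_k -> R) : 0 < r ->
  lnorm r%:E u `^ r = \sum_i `|u i| `^ r.
Proof.
move=> r0; rewrite /= -powRrM mulVf ?gt_eqF// powRr1//.
by rewrite sumr_ge0// => i _; rewrite powR_ge0.
Qed.

Lemma ler_powR2r (r x y : R) : 0 < r -> 0 <= x -> 0 <= y ->
  (x `^ r <= y `^ r) = (x <= y).
Proof.
move=> r0 x0 y0; apply/idP/idP => [|xy]; last first.
  by apply: ge0_ler_powR; rewrite ?nnegrE//; exact: ltW.
by apply: contraTT; rewrite -!ltNge; apply: gt0_ltr_powR; rewrite ?nnegrE.
Qed.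

Lemma lnorm_leP (r : R) k (u : 'I_k -> R) (K : R) : 0 < r -> 0 <= K ->
  (lnorm r%:E u <= K) = (\sum_i `|u i| `^ r <= K `^ r).
Proof.
by move=> r0 K0; rewrite -lnorm_powR// ler_powR2r ?lnorm_ge0.
Qed.

Lemma lnorm_y_leP k (u : 'I_k -> R) (K : R) : 0 <= K ->
  lnorm +oo%E u <= K <-> forall i, `|u i| <= K.
Proof.
move=> K0; split => [h i|h].
  by apply: le_trans h => /=; rewrite (bigD1 i)//= le_max lexx.
by rewrite /=; elim/big_ind: _ => // a b aK bK; rewrite ge_max aK.
Qed.

Lemma ler_norm_lnorm r k (u : 'I_k -> R) i : (1 <= r)%E -> `|u i| <= lnorm r u.
Proof.
case: r => [r| |]// r1; last by move: i; apply/lnorm_y_leP => //; exact: lnorm_ge0.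
have r0 : 0 < r by rewrite lee_fin in r1; lra.
rewrite -(ler_powR2r _ _ _ r0) ?lnorm_ge0// lnorm_powR//.
by rewrite (bigD1 i)//= lerDl sumr_ge0// => j _; rewrite powR_ge0.
Qed.

Lemma le_lnorm r k (u v : 'I_k -> R) : (1 <= r)%E ->
  (forall i, `|u i| <= `|v i|) -> lnorm r u <= lnorm r v.
Proof.
case: r => [r| |] r1 uv; last by [].
  rewrite lee_fin in r1; have r0 : 0 < r by lra.
  rewrite lnorm_leP ?lnorm_ge0// lnorm_powR//; apply: ler_sum => i _.
  by rewrite ler_powR2r.
apply/lnorm_y_leP => [|i]; first exact: lnorm_ge0.
by apply: le_trans (uv i) _; exact: ler_norm_lnorm.
Qed.

Lemma lnorm0 r k : (1 <= r)%E -> lnorm r (fun _ : 'I_k => 0) = 0 :> R.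
Proof.
case: r => [r| |]// r1; last first.
  apply/eqP; rewrite eq_le lnorm_ge0 andbT.
  by apply/lnorm_y_leP => // i; rewrite normr0.
rewrite lee_fin in r1; rewrite /= big1 => [|i _].
  by rewrite powR0// invr_eq0; lra.
by rewrite normr0 powR0//; lra.
Qed.

Lemma lnormZ r k (c : R) (u : 'I_k -> R) : (1 <= r)%E -> 0 <= c ->
  lnorm r (fun i => c * u i) = c * lnorm r u.
Proof.
case: r => [r| |]// r1 c0 /=; last first.
  transitivity (\big[Num.max/0]_(i < k) (c * `|u i|)).
    by apply: eq_bigr => i _; rewrite normrM ger0_norm.
  elim/big_ind2 : _ => [|a b a' b' -> ->|//]; first by rewrite mulr0.
  by rewrite maxr_pMr.
rewrite lee_fin in r1; have r0 : r != 0 by lra.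
transitivity ((c `^ r * \sum_(i < k) `|u i| `^ r) `^ r^-1).
  by rewrite mulr_sumr; congr (_ `^ _); apply: eq_bigr => i _;
    rewrite normrM ger0_norm// powRM.
rewrite powRM ?powR_ge0// ?sumr_ge0//.
by rewrite -powRrM mulfV// powRr1.
Qed.

Lemma lnorm1 r (u : 'I_1 -> R) : (1 <= r)%E -> lnorm r u = `|u 0|.
Proof.
case: r => [r| |]// r1 /=; last by rewrite big_ord_recl big_ord0 max_l.
rewrite lee_fin in r1; have r0 : r != 0 by lra.
by rewrite big_ord1 -powRrM mulfV// powRr1.
Qed.

(** If [q <= r], entries of absolute value at most 1 satisfy [|u i| ^ r <= |u i| ^ q], and no power
    of [k] is lost. If [r < q], the power mean inequality with exponent [q / r] produces the factor
    [k ^ (1/r - 1/q)]. Infinite exponents only use the bound on the entries. *)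
Lemma lnorm_compare (r q : \bar R) k (u : 'I_k -> R) :
  (1 <= r)%E -> (1 <= q)%E -> lnorm q u <= 1 ->
  lnorm r u <= k%:R `^ Num.max (rinv r - rinv q) 0.
Proof.
move=> r1 q1 u1; rewrite /rinv.
have u1i i : `|u i| <= 1 by apply: le_trans u1; exact: ler_norm_lnorm.
have [k0|k0] := posnP k.
  have -> : lnorm r u = lnorm r (fun _ : 'I_k => 0).
    by congr (lnorm r _); apply/funext => i; have := ltn_ord i; rewrite [X in (_ < X)%N]k0.
  by rewrite lnorm0// powR_ge0.
have kp : 0 < k%:R :> R by rewrite ltr0n.
case: r r1 => [r| |]// r1; case: q q1 u1 => [q| |]// q1 u1; last first.
- by rewrite invey/= subrr maxxx powRr0; apply/lnorm_y_leP.
- rewrite lee_fin in q1; have q0 : 0 < q by lra.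
  rewrite inver gt_eqF// invey/= sub0r max_r ?powRr0; last first.
    by rewrite oppr_le0 invr_ge0 ltW.
  exact/lnorm_y_leP.
- rewrite lee_fin in r1; have r0 : 0 < r by lra.
  rewrite inver gt_eqF// invey/= subr0 max_l ?invr_ge0 ?(ltW r0)//.
  rewrite lnorm_leP// ?powR_ge0// -powRrM mulVf ?gt_eqF// powRr1 ?(ltW kp)//.
  rewrite -[X in _ <= X%:R](card_ord k) -sum1_card natr_sum; apply: ler_sum => i _.
  by have := ler_powR2r _ _ _ r0 (normr_ge0 (u i)) ler01; rewrite powR1 u1i => ->.
rewrite !lee_fin in r1 q1; have r0 : 0 < r by lra.
have q0 : 0 < q by lra.
rewrite !inver !gt_eqF//=.
have {}u1 : \sum_i `|u i| `^ q <= 1 by move: u1; rewrite lnorm_leP// powR1.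
have [qr|rq] := leP q r.
  rewrite max_r ?subr_le0 ?lef_pV2// powRr0 lnorm_leP// powR1.
  apply: le_trans u1; apply: ler_sum => i _.
  have [->|ui0] := eqVneq (`|u i|) 0; first by rewrite !powR0 ?gt_eqF.
  by apply: ger_powR => //; rewrite u1i lt0r ui0 normr_ge0.
rewrite max_l; last by rewrite subr_ge0 lef_pV2//; exact: ltW.
rewrite lnorm_leP ?powR_ge0// -powRrM mulrBl mulVf ?gt_eqF//.
rewrite powRD ?(gt_eqF kp) ?implybT// powRr1 ?(ltW kp)// -ler_pdivrMl//.
have s0 : 0 < q / r by rewrite divr_gt0.
rewrite -(ler_powR2r _ _ _ s0) ?powR_ge0//; last first.
  by rewrite mulr_ge0 ?invr_ge0 ?(ltW kp)// sumr_ge0// => i _; rewrite powR_ge0.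
rewrite mulrC; apply: (@le_trans _ _ ((\sum_i (`|u i| `^ r) `^ (q / r)) / k%:R)).
  rewrite -[X in X%:R](card_ord k); apply: power_mean => [|i]; last exact: powR_ge0.
  by rewrite ler_pdivlMr// mul1r ltW.
rewrite -powRrM (_ : - (q^-1 * r) * (q / r) = -1); last by field; rewrite !gt_eqF.
rewrite powR_inv1 ?(ltW kp)// ler_pdivrMr// mulVf ?gt_eqF//.
under eq_bigr do rewrite -powRrM mulrC divfK ?gt_eqF//.
exact: u1.
Qed.

End LNorm.

(** * Conjugate exponents and Hoelder's inequality *)

Section Hoelder.
Context {R : realType}.

(** The conjugate is [p / (p - 1)]. The last clause places it in the range of Khintchine's
    inequality. *)
Lemma hoelder_conjugate_fin (p : R) : 1 < p -> exists s : R,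
  [/\ hoelder_conjugate p%:E = s%:E, p^-1 + s^-1 = 1, 1 <= s & p <= 2 -> 2 <= s].
Proof.
move=> p1; exists (p / (p - 1)).
have p0 : p != 0 by rewrite gt_eqF//; lra.
have pm : 0 < p - 1 by lra.
split.
- rewrite /hoelder_conjugate/= eqe (negbTE p0) -EFinB inver gt_eqF//.
- by field; rewrite p0 gt_eqF.
- by rewrite ler_pdivlMr//; lra.
- by rewrite ler_pdivlMr//; lra.
Qed.

(** For [p > 1], Young's inequality is applied to [|u i|] and [|v i| / T] with [T] the norm of [v];
    the two resulting sums contribute at most [1/p] and [1/s], which add up to 1. *)
Lemma hoelder_sum (p : R) k (u v : 'I_k -> R) : 1 <= p -> lnorm p%:E u <= 1 ->
  `|\sum_i u i * v i| <= lnorm (hoelder_conjugate p%:E) v.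
Proof.
move=> p1 u1; apply: le_trans (ler_norm_sum _ _ _) _.
under eq_bigr do rewrite normrM.
have p0 : 0 < p by lra.
move: u1; rewrite lnorm_leP// powR1.
have [->|pn1] := eqVneq p 1.
  rewrite hoelder_conjugate1 => u1; set T := lnorm +oo%E v.
  apply: (@le_trans _ _ (\sum_i `|u i| `^ 1 * T)); last first.
    by rewrite -mulr_suml ler_piMl// lnorm_ge0.
  by apply: ler_sum => i _; rewrite powRr1// ler_wpM2l// ler_norm_lnorm ?leey.
have [|s [-> ps s1 _]] := hoelder_conjugate_fin p; first by rewrite lt_neqAle eq_sym pn1.
move=> u1; have s0 : 0 < s by lra.
set T := lnorm s%:E v; have T0 : 0 <= T := lnorm_ge0 _ _ _.
have [T00|Tn0] := eqVneq T 0.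
  rewrite big1 => [//|i _].
  have : `|v i| <= T by apply: ler_norm_lnorm; rewrite lee_fin.
  by rewrite T00 normr_le0 => /eqP ->; rewrite normr0 mulr0.
have Tp : 0 < T by rewrite lt0r Tn0.
rewrite -[leRHS]mul1r -ler_pdivrMr// mulr_suml.
apply: (@le_trans _ _ (\sum_i (`|u i| `^ p / p + (`|v i| / T) `^ s / s))).
  apply: ler_sum => i _; rewrite -mulrA.
  by apply: conjugate_powR => //; exact: divr_ge0.
rewrite big_split/= -!mulr_suml -ps lerD//.
  by rewrite ler_piMl// invr_ge0 ltW.
rewrite ler_piMl ?invr_ge0 ?(ltW s0)//.
under eq_bigr do rewrite powRM ?invr_ge0//.
by rewrite -mulr_suml -lnorm_powR// -/T -powRM ?invr_ge0// mulfV// powR1.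
Qed.

End Hoelder.

(** * Rademacher sums: exponential moments, Khintchine and Massart *)

Section RademacherSums.
Context {R : realType}.

(** The value [true] encodes the sign -1. Expectations are kept as unnormalised sums over the
    [2 ^ m] sign vectors. *)
Definition rsum {m} (xi : {ffun 'I_m -> bool}) (a : 'I_m -> R) : R :=
  \sum_(i < m) (-1) ^+ xi i * a i.

Lemma rsumZ m (xi : {ffun 'I_m -> bool}) (c : R) (a : 'I_m -> R) :
  rsum xi (fun i => c * a i) = c * rsum xi a.
Proof. by rewrite /rsum mulr_sumr; apply: eq_bigr => i _; rewrite mulrCA. Qed.

Lemma card_signs m : #|{ffun 'I_m -> bool}| = (2 ^ m)%N.
Proof. by rewrite card_ffun card_bool card_ord. Qed.

(** By independence of the signs the sum factors into a product of terms [2 cosh (l * a i)], each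
    bounded by [expR_cosh_le]. *)
Lemma rsum_mgf m (a : 'I_m -> R) (l : R) : \sum_i a i ^+ 2 <= 1 ->
  \sum_xi expR (l * rsum xi a) <= 2 ^+ m * expR (l ^+ 2 / 2).
Proof.
move=> a1.
pose F (i : 'I_m) (b : bool) : R := expR (l * ((-1) ^+ b * a i)).
have -> : \sum_xi expR (l * rsum xi a) =
    \sum_(xi : {ffun 'I_m -> bool}) \prod_i F i (xi i).
  by apply: eq_bigr => xi _; rewrite /rsum mulr_sumr expR_sum.
rewrite -bigA_distr_bigA/=.
apply: (@le_trans _ _ (\prod_(i < m) (2 * expR ((l * a i) ^+ 2 / 2)))).
  apply: ler_prod => i _; rewrite big_bool /F/= expr0 expr1 mul1r mulN1r mulrN.
  by rewrite addr_ge0 ?expR_ge0//= -ler_pdivrMl// mulrC addrC expR_cosh_le.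
rewrite big_split/= prodr_const card_ord -expR_sum ler_wpM2l ?exprn_ge0//.
rewrite ler_expR -mulr_suml ler_pM2r//.
by under eq_bigr do rewrite exprMn; rewrite -mulr_sumr ler_piMr// sqr_ge0.
Qed.

Lemma expR_norm_le (t : R) : expR `|t| <= expR t + expR (- t).
Proof.
by have [] := ger0P t => _; rewrite ?lerDl ?lerDr expR_ge0.
Qed.

Lemma rsum_mgf_norm m (a : 'I_m -> R) (l : R) : 0 <= l -> \sum_i a i ^+ 2 <= 1 ->
  \sum_xi expR (l * `|rsum xi a|) <= 2 * 2 ^+ m * expR (l ^+ 2 / 2).
Proof.
move=> l0 a1.
apply: (@le_trans _ _ (\sum_xi (expR (l * rsum xi a) + expR (- l * rsum xi a)))).
  apply: ler_sum => xi _; rewrite -[X in X * `|_|]ger0_norm// -normrM mulNr.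
  exact: expR_norm_le.
rewrite big_split/= -mulrA mulr_natl mulr2n lerD// ?rsum_mgf//.
by rewrite -[in leRHS]sqrrN rsum_mgf.
Qed.

(* Khintchine's inequality with constant [sqrt r]: integrate
   [(t / r) ^ r <= e^(t - r)] at [t = sqrt r * |S|]. *)
Lemma khintchine m (a : 'I_m -> R) (r : R) : 2 <= r -> \sum_i a i ^+ 2 <= 1 ->
  \sum_xi `|rsum xi a| `^ r <= 2 ^+ m * Num.sqrt r `^ r.
Proof.
move=> r2 a1; have r0 : 0 < r by lra.
set s := Num.sqrt r; have s0 : 0 <= s by rewrite sqrtr_ge0.
have ss : s ^+ 2 = r by rewrite sqr_sqrtr// ltW.
have sp : 0 < s by rewrite sqrtr_gt0.
apply: (@le_trans _ _ (\sum_xi s `^ r * (expR (- r) * expR (s * `|rsum xi a|)))).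
  apply: ler_sum => xi _; set t := `|_|; have t0 : 0 <= t by exact: normr_ge0.
  have -> : t = s * (s * t / r) by rewrite -ss; field; rewrite gt_eqF.
  have h0 : 0 <= s * t / r by rewrite divr_ge0 ?mulr_ge0// ltW.
  rewrite powRM// ler_wpM2l ?powR_ge0//.
  apply: (@le_trans _ _ (expR (s * t / r - 1) `^ r)).
    rewrite ler_powR2r ?expR_ge0//. have := expR_ge1Dx (s * t / r - 1); lra.
  rewrite -expRM mulrBl divfK ?gt_eqF// mul1r addrC expRD.
  suff -> : s * (s * t / r) = t by [].
  by rewrite -ss; field; rewrite gt_eqF.
rewrite -mulr_sumr mulrC ler_wpM2r ?powR_ge0// -mulr_sumr.
apply: (@le_trans _ _ (expR (- r) * (2 * 2 ^+ m * expR (r / 2)))).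
  by rewrite ler_wpM2l ?expR_ge0// -ss rsum_mgf_norm.
have Er : expR (- r) = (expR (r / 2) ^+ 2)^-1.
  by rewrite expRN -expRM_natr divfK.
have -> : expR (- r) * (2 * 2 ^+ m * expR (r / 2)) = 2 ^+ m * (2 / expR (r / 2)).
  by rewrite Er; field; rewrite expR_eq0.
(* The leftover factor [2 / e^(r/2)] is at most 1, since [e^(r/2) >= 1 + r/2 >= 2]; this uses
   [2 <= r]. *)
rewrite ler_piMr ?exprn_ge0// ler_pdivrMr ?expR_gt0// mul1r.
by have := expR_ge1Dx (r / 2); lra.
Qed.

(* Massart's maximal inequality, from [1 + u <= e^u] instead of Jensen. *)
Lemma massart n m (a : 'I_n -> 'I_m -> R) (M : {ffun 'I_m -> bool} -> R) :
  (0 < n)%N -> (forall j, \sum_i a j i ^+ 2 <= 1) ->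
  (forall xi, exists j, M xi <= `|rsum xi (a j)|) ->
  \sum_xi M xi <= 2 ^+ m * Num.sqrt (4 * ln (2 * n%:R)).
Proof.
move=> n0 a1 Mle; set L := ln _.
have n1 : 1 <= n%:R :> R by rewrite ler1n.
have L0 : 0 < L by rewrite ln_gt0//; lra.
set s := Num.sqrt L; have s0 : 0 <= s by rewrite sqrtr_ge0.
have ss : s ^+ 2 = L by rewrite sqr_sqrtr// ltW.
have sp : 0 < s by rewrite sqrtr_gt0.
have -> : Num.sqrt (4 * L) = 2 * s.
  by rewrite sqrtrM// (_ : 4 = 2 ^+ 2) ?sqrtr_sqr ?ger0_norm//; lra.
(* The shift [L + L / 2] is chosen so that, once the largest term is bounded by the sum over [j],
   the total [2 * n * 2 ^ m * e^(L/2)] is brought down to [2 ^ m], because [e^L = 2 * n]. *)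
have key : \sum_xi (1 + (s * M xi - L - L / 2)) <= 2 ^+ m.
  apply: (@le_trans _ _ (\sum_xi \sum_j expR (- L - L / 2) * expR (s * `|rsum xi (a j)|))).
    apply: ler_sum => xi _; have [j Mj] := Mle xi.
    rewrite (bigD1 j)//= -expRD.
    apply: (@le_trans _ _ (expR (- L - L / 2 + s * `|rsum xi (a j)|))).
      apply: le_trans (expR_ge1Dx _) _; rewrite ler_expR.
      by have := ler_wpM2l s0 Mj; lra.
    by rewrite lerDl sumr_ge0// => i _; rewrite mulr_ge0 ?expR_ge0.
  rewrite exchange_big/=.
  apply: (@le_trans _ _ (\sum_(j < n) expR (- L - L / 2) * (2 * 2 ^+ m * expR (L / 2)))).
    apply: ler_sum => j _; rewrite -mulr_sumr ler_wpM2l ?expR_ge0//.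
    by rewrite -ss rsum_mgf_norm.
  rewrite sumr_const card_ord -mulr_natr expRD -mulrA expRN [expR (- _)]expRN.
  rewrite lnK ?posrE; last by lra.
  rewrite le_eqVlt; apply/orP; left; apply/eqP; field.
  by rewrite expR_eq0/= gt_eqF//; lra.
move: key; rewrite big_split/= !sumrB -mulr_sumr !sumr_const card_signs -ss.
rewrite -[(s ^+ 2) *+ _]mulr_natr -[(s ^+ 2 / 2) *+ _]mulr_natr natrX.
set S := \sum_xi M xi; set K := 2 ^+ m => key.
have K0 : 0 < K by rewrite exprn_gt0.
(* Here [key] reads [s * S <= 3/2 * s ^ 2 * K], so the constant 2 leaves some slack. *)
rewrite -(ler_pM2l sp) (_ : s * (K * (2 * s)) = 2 * s ^+ 2 * K); last by ring.
have h : 0 <= s ^+ 2 * K := mulr_ge0 (sqr_ge0 s) (ltW K0).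
move: key; lra.
Qed.

End RademacherSums.

(** * Rademacher averages of vectors in the [r]-norm, for [r >= 2] *)

Section VectorRademacher.
Context {R : realType}.

Lemma exists_maximum (I : finType) (F : I -> R) : I -> exists i, forall j, F j <= F i.
Proof.
move=> i0; exists [arg max_(i > i0) F i]%O.
by case: arg_maxP => // i _ h j; exact: h.
Qed.

(** Since [r / 2 >= 1], the power mean inequality over the [m] samples moves the exponent onto the
    single entries; exchanging the two sums then leaves the norms of the individual samples. *)
Lemma lnorm_sqrt_sum_sqr (r : \bar R) n m (V : 'I_n -> 'I_m -> R) (Q : R) :
  (0 < m)%N -> (2%:E <= r)%E -> 0 <= Q ->
  (forall i, lnorm r (fun j => V j i) ^+ 2 <= Q) ->
  lnorm r (fun j => Num.sqrt (\sum_i V j i ^+ 2)) <= Num.sqrt (m%:R * Q).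
Proof.
move=> m0 r2 Q0 VQ; have mp : 0 < m%:R :> R by rewrite ltr0n.
have r1 : (1 <= r)%E by apply: le_trans r2; rewrite lee_fin; lra.
have {}VQ i : lnorm r (fun j => V j i) <= Num.sqrt Q.
  by rewrite -[leLHS]ger0_norm ?lnorm_ge0// -sqrtr_sqr ler_wsqrtr.
case: r r1 r2 VQ => [r| |]// r1 r2 VQ; last first.
  apply/lnorm_y_leP => [|j]; first exact: sqrtr_ge0.
  rewrite ger0_norm ?sqrtr_ge0// ler_wsqrtr//.
  apply: (@le_trans _ _ (\sum_(i < m) Q)); last by rewrite sumr_const card_ord mulr_natl.
  apply: ler_sum => i _; rewrite -[leRHS](sqr_sqrtr Q0) -[leLHS]real_normK ?num_real//.
  rewrite lerXn2r ?nnegrE ?sqrtr_ge0//.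
  by move: j; apply/lnorm_y_leP; [exact: sqrtr_ge0 | exact: VQ].
rewrite lee_fin in r2; have r0 : 0 < r by lra.
rewrite lnorm_leP ?sqrtr_ge0//.
have sqrtE (t : R) : 0 <= t -> Num.sqrt t `^ r = t `^ (r / 2).
  by move=> t0; rewrite -powR12_sqrt// -powRrM mulrC.
have sqrE (t : R) : (t ^+ 2) `^ (r / 2) = `|t| `^ r.
  by rewrite -sqrtE ?sqr_ge0// sqrtr_sqr.
rewrite sqrtE ?mulr_ge0// ?(ltW mp)//.
pose c : R := m%:R `^ (r / 2) / m%:R.
have c0 : 0 <= c by rewrite divr_ge0 ?powR_ge0.
apply: (@le_trans _ _ (\sum_j c * \sum_i `|V j i| `^ r)).
  apply: ler_sum => j _; set X := \sum_i V j i ^+ 2.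
  have X0 : 0 <= X by rewrite sumr_ge0// => i _; rewrite sqr_ge0.
  rewrite ger0_norm ?sqrtr_ge0// sqrtE//.
  have -> : X = m%:R * (X / m%:R) by field; rewrite gt_eqF.
  rewrite powRM ?divr_ge0// /c -mulrA [_^-1 * _]mulrC ler_wpM2l ?powR_ge0//.
  under [in leRHS]eq_bigr do rewrite -sqrE.
  have := @power_mean R _ (fun i => V j i ^+ 2) (r / 2).
  by rewrite card_ord; apply => [|i]; [lra|rewrite sqr_ge0].
rewrite -mulr_sumr exchange_big/=.
apply: (@le_trans _ _ (c * \sum_(i < m) Q `^ (r / 2))).
  rewrite ler_wpM2l//; apply: ler_sum => i _.
  by rewrite -sqrtE// -lnorm_leP ?sqrtr_ge0.
rewrite sumr_const card_ord -[_ *+ m]mulr_natl mulrA divfK ?gt_eqF//.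
by rewrite powRM ?(ltW mp).
Qed.

(** Each coordinate is written as its standard deviation [sg j] times a normalised sum [b j].
    Massart gives the logarithmic constant, which also settles [r = +oo]; Khintchine gives the
    constant [r]. *)
Lemma rademacher_lnorm (r : \bar R) n m (V : 'I_n -> 'I_m -> R) (Q : R) :
  (0 < n)%N -> (0 < m)%N -> (2%:E <= r)%E -> 0 <= Q ->
  (forall i, lnorm r (fun j => V j i) ^+ 2 <= Q) ->
  \sum_xi lnorm r (fun j => rsum xi (V j)) <=
  2 ^+ m * Num.sqrt (fine (Order.min r (4 * ln (2 * n%:R))%:E) * (m%:R * Q)).
Proof.
move=> n0 m0 r2 Q0 VQ.
have r1 : (1 <= r)%E by apply: le_trans r2; rewrite lee_fin; lra.
pose sg j := Num.sqrt (\sum_i V j i ^+ 2).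
have sg0 j : 0 <= sg j by exact: sqrtr_ge0.
have sgQ : lnorm r sg <= Num.sqrt (m%:R * Q) by exact: lnorm_sqrt_sum_sqr.
pose b j i := V j i / sg j.
have sum0 j : 0 <= \sum_i V j i ^+ 2 by apply: sumr_ge0 => i _; exact: sqr_ge0.
have b1 j : \sum_i b j i ^+ 2 <= 1.
  rewrite /b; under eq_bigr do rewrite exprMn.
  rewrite -mulr_suml exprVn sqr_sqrtr//.
  by have [->|?] := eqVneq (\sum_i V j i ^+ 2) 0; rewrite ?mul0r// divff.
have Vb j xi : rsum xi (V j) = sg j * rsum xi (b j).
  rewrite -rsumZ; congr rsum; apply/funext => i; rewrite /b.
  have [s0|s0] := eqVneq (sg j) 0; last by rewrite mulrCA divff// mulr1.
  (* When [sg j = 0] the quotient [b j i] is 0 by convention, and the identity survives because all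
     [V j i] vanish. *)
  rewrite s0 mul0r; apply/eqP; rewrite -sqrf_eq0; apply/eqP.
  move/eqP : s0; rewrite /sg sqrtr_eq0 => s0.
  apply: (psumr_eq0P (P := xpredT) (F := fun i => V j i ^+ 2)) => //.
    by move=> k _; exact: sqr_ge0.
  by apply/eqP; rewrite eq_le s0 sum0.
have L0 : 0 <= 4 * ln (2 * n%:R) :> R.
  have n1 : 1 <= n%:R :> R by rewrite ler1n.
  by rewrite mulr_ge0// ln_ge0//; lra.
have massart_case : \sum_xi lnorm r (fun j => rsum xi (V j)) <=
    2 ^+ m * Num.sqrt (4 * ln (2 * n%:R) * (m%:R * Q)).
  (* The largest normalised sum factors out of the norm, leaving the norm of [sg]. *)
  have /choice[jm jmP] (xi : {ffun 'I_m -> bool}) :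
    exists j : 'I_n, forall j', `|rsum xi (b j')| <= `|rsum xi (b j)|.
    exact: (exists_maximum _ _ (Ordinal n0)).
  apply: (@le_trans _ _ (\sum_xi `|rsum xi (b (jm xi))| * lnorm r sg)).
    apply: ler_sum => xi _; rewrite -lnormZ//; apply: le_lnorm => // j.
    by rewrite Vb !normrM mulrC normr_id ler_wpM2r.
  rewrite -mulr_suml sqrtrM// mulrA ler_pM ?sumr_ge0 ?lnorm_ge0//.
  apply: (massart _ _ b) => // xi; by exists (jm xi).
case: r r2 r1 sgQ VQ massart_case => [r| |]// r2 r1 sgQ VQ massart_case.
have [rL|Lr] := leP r (4 * ln (2 * n%:R)); last by rewrite min_r// lee_fin ltW.
rewrite min_l ?lee_fin//; rewrite lee_fin in r2; rewrite -[fine _]/r.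
have r0 : 0 < r by lra.
rewrite sqrtrM ?(ltW r0)//.
set Y := fun xi : {ffun 'I_m -> bool} => lnorm r%:E (fun j => rsum xi (V j)).
clear massart_case VQ.
have kh j : \sum_xi `|rsum xi (b j)| `^ r <= 2 ^+ m * Num.sqrt r `^ r.
  exact: (khintchine m (b j) r r2 (b1 j)).
have := sqrtr_ge0 r; move: (Num.sqrt r) kh => s kh s0.
have tm0 : 0 < 2 ^+ m :> R by rewrite exprn_gt0.
rewrite mulrC -ler_pdivrMr//.
have Y0 xi : 0 <= Y xi := lnorm_ge0 _ _ _.
have := lnorm_powR r _ sg r0; have := lnorm_ge0 r%:E _ sg.
move: (lnorm r%:E sg) sgQ => K KQ K0 Kr.
apply: (@le_trans _ _ (s * K)); last exact: ler_wpM2l.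
rewrite -(ler_powR2r _ _ _ r0); last 2 first.
- by apply: divr_ge0 (ltW tm0); apply: sumr_ge0 => xi _; exact: Y0.
- exact: (mulr_ge0 s0 K0).
have rr : 1 <= r by lra.
(* Averaging over sign vectors, the power [r] moves inside the expectation; there the norm is a sum
   over coordinates and Khintchine applies to each. *)
have := @power_mean R _ Y r rr Y0.
rewrite card_signs natrX => /le_trans; apply.
rewrite (powRM _ s0 K0) (ler_pdivrMr _ _ tm0) Kr.
have -> : \sum_xi Y xi `^ r =
    \sum_xi \sum_j `|sg j| `^ r * `|rsum xi (b j)| `^ r.
  apply: eq_bigr => xi _; rewrite /Y (lnorm_powR r _ _ r0).
  by apply: eq_bigr => j _; rewrite Vb normrM powRM.
rewrite exchange_big mulr_sumr mulr_suml; apply: ler_sum => j _ /=.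
rewrite -mulr_sumr -mulrA mulrCA; apply: ler_wpM2l; first exact: powR_ge0.
by rewrite mulrC; exact: kh.
Qed.

End VectorRademacher.

(** * The contraction principle, in terms of selectors *)

Section Contraction.
Context {R : realType} {m : nat}.
Local Notation signs := {ffun 'I_m -> bool}.
Implicit Types (xi : signs) (T : set ('I_m -> R)).

Definition flip (i0 : 'I_m) xi : signs :=
  [ffun i => if i == i0 then ~~ xi i else xi i].

Definition neg xi : signs := [ffun i => ~~ xi i].

Lemma flipK i0 : involutive (flip i0).
Proof.
by move=> xi; apply/ffunP => i; rewrite !ffunE; case: eqP; rewrite ?negbK.
Qed.

Lemma negK : involutive neg.
Proof. by move=> xi; apply/ffunP => i; rewrite !ffunE negbK. Qed.

Lemma rsum_neg xi (a : 'I_m -> R) : rsum (neg xi) a = - rsum xi a.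
Proof.
rewrite /rsum -sumrN; apply: eq_bigr => i _.
by rewrite ffunE signrN mulNr.
Qed.

(* The two sign vectors [xi] and [flip i0 xi] may exchange their points, and one
   of the two assignments realises [+ |t i0 - t' i0|] in coordinate [i0]. *)
Lemma contraction_step T (phi : 'I_m -> R -> R) (i0 : 'I_m) (t : signs -> 'I_m -> R) :
  (forall a b, `|phi i0 a - phi i0 b| <= `|a - b|) -> (forall xi, T (t xi)) ->
  exists2 s : signs -> 'I_m -> R, (forall xi, T (s xi)) &
    \sum_xi rsum xi (fun i => phi i (t xi i)) <=
    \sum_xi rsum xi (fun i => (if i == i0 then id else phi i) (s xi i)).
Proof.
move=> lip Tt; pose swap xi := (-1) ^+ xi i0 * (t xi i0 - t (flip i0 xi) i0) < 0.
pose s xi := if swap xi then t (flip i0 xi) else t xi.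
exists s => [xi|]; first by rewrite /s; case: ifP.
pose A xi (u : 'I_m -> R) := \sum_(i | i != i0) (-1) ^+ xi i * phi i (u i).
have A_flip xi u : A (flip i0 xi) u = A xi u.
  by apply: eq_bigr => i /negbTE ii0; rewrite ffunE ii0.
(* Pairing each sign vector with its flip reduces the inequality between sums to one for each
   pair. *)
have sumE (F : signs -> R) : \sum_xi F xi = (\sum_xi (F xi + F (flip i0 xi))) / 2.
  have e : \sum_xi F xi = \sum_xi F (flip i0 xi).
    exact: (reindex_inj (inv_inj (flipK i0))).
  by rewrite big_split/= -e; lra.
rewrite sumE [leRHS]sumE ler_pM2r//; apply: ler_sum => xi _.
have rsumE (f : 'I_m -> R -> R) xi' u : (forall i, i != i0 -> f i = phi i) ->
    rsum xi' (fun i => f i (u i)) = (-1) ^+ xi' i0 * f i0 (u i0) + A xi' u.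
  move=> fphi; rewrite /rsum (bigD1 i0)//=; congr (_ + _).
  by apply: eq_bigr => i ii0; rewrite fphi.
pose psi i := if i == i0 then id else phi i.
have psiE i : i != i0 -> psi i = phi i by rewrite /psi => /negbTE ->.
rewrite !(rsumE phi)// !(rsumE psi)// !A_flip /psi eqxx/=.
have flip0 : (-1) ^+ flip i0 xi i0 = - (-1) ^+ xi i0 :> R.
  by rewrite ffunE eqxx signrN.
rewrite flip0.
have swap_flip : swap (flip i0 xi) = swap xi.
  by rewrite /swap flip0 flipK mulNr -mulrN opprB.
rewrite /s swap_flip flipK.
set e := (-1) ^+ xi i0; set a := t xi; set b := t (flip i0 xi).
have e1 : `|e| = 1 by rewrite /e normr_sign.
have : e * (phi i0 (a i0) - phi i0 (b i0)) <= `|e * (a i0 - b i0)|.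
  apply: le_trans (ler_norm _) _; rewrite !normrM e1 !mul1r; exact: lip.
have -> : swap xi = (e * (a i0 - b i0) < 0) by [].
by case: ltP => [/ltr0_norm ->|/ger0_norm ->]; lra.
Qed.

(** Induction on the list of coordinates where [phi] has already been replaced by the identity, one
    [contraction_step] per coordinate. *)
Lemma contraction_selector T (phi : R -> R) (t : signs -> 'I_m -> R) :
  (forall a b, `|phi a - phi b| <= `|a - b|) -> (forall xi, T (t xi)) ->
  exists2 s : signs -> 'I_m -> R, (forall xi, T (s xi)) &
    \sum_xi rsum xi (phi \o t xi) <= \sum_xi rsum xi (s xi).
Proof.
move=> lip Tt.
have /(_ (enum 'I_m))[s Ts] : forall l : seq 'I_m,
  exists2 s : signs -> 'I_m -> R, (forall xi, T (s xi)) &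
    \sum_xi rsum xi (phi \o t xi) <=
    \sum_xi rsum xi (fun i => (if i \in l then id else phi) (s xi i)).
  elim=> [|i0 l [s Ts IH]]; first by exists t.
  have := @contraction_step T (fun i => if i \in l then id else phi) i0 s.
  move=> /(_ _ Ts)[|s' Ts' le'].
    by move=> a b; case: (i0 \in l); [exact: lexx | exact: lip].
  exists s' => //; apply: le_trans IH _; apply: le_trans le' _.
  rewrite le_eqVlt; apply/orP; left; apply/eqP; apply: eq_bigr => xi _.
  apply: eq_bigr => i _; rewrite in_cons; case: eqP => [->|] //=.
under [X in _ <= X -> _]eq_bigr => xi _ do under eq_fun do rewrite mem_enum.
by exists s.
Qed.

(** The absolute value is split into positive and negative parts. The negative part at [xi] is a
    positive part at [neg xi], so each part is a signed sum over a selector and costs one [M]. *)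
Lemma rademacher_contraction T (phi : R -> R) (M : R) (t : signs -> 'I_m -> R) :
  (forall a b, `|phi a - phi b| <= `|a - b|) -> phi 0 = 0 -> T (fun=> 0) ->
  (forall s : signs -> 'I_m -> R, (forall xi, T (s xi)) ->
    \sum_xi `|rsum xi (s xi)| <= M) ->
  (forall xi, T (t xi)) -> \sum_xi `|rsum xi (phi \o t xi)| <= 2 * M.
Proof.
move=> lip phi0 T0 TM Tt.
have contr s : (forall xi, T (s xi)) -> \sum_xi rsum xi (phi \o s xi) <= M.
  move=> /(contraction_selector _ _ _ lip)[s' Ts' /le_trans]; apply.
  apply: le_trans (TM _ Ts'); apply: ler_sum => xi _; exact: ler_norm.
have rsum0 xi : rsum xi (phi \o fun=> 0) = 0.
  by rewrite /rsum big1// => i _; rewrite /= phi0 mulr0.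
(* Where the sum has the wrong sign, the zero point is selected instead; it contributes nothing
   because [phi 0 = 0]. *)
pose t1 xi := if 0 <= rsum xi (phi \o t xi) then t xi else fun=> 0.
pose t2 xi := if rsum (neg xi) (phi \o t (neg xi)) <= 0 then t (neg xi) else fun=> 0.
have -> : 2 * M = M + M by lra.
have T1 : forall xi, T (t1 xi) by move=> xi; rewrite /t1; case: ifP.
have T2 : forall xi, T (t2 xi) by move=> xi; rewrite /t2; case: ifP.
apply: le_trans (lerD (contr _ T1) (contr _ T2)).
rewrite [X in _ <= _ + X](reindex_inj (inv_inj negK))/= -big_split/=.
apply: ler_sum => xi _; rewrite rsum_neg /t1 /t2 negK.
have [r0|r0] := ger0P (rsum xi (phi \o t xi)).
  rewrite lerDl oppr_ge0; case: ifP => //.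
  by rewrite rsum0.
by rewrite rsum0 (ltW r0) add0r.
Qed.

End Contraction.

(** * Norms of weight matrices *)

Section MatrixNorm.
Context {R : realType} (p q : \bar R).
Hypotheses (p1 : (1 <= p)%E) (q1 : (1 <= q)%E).

Lemma mxnorm_ge0 m n (W : 'M[R]_(m, n)) : 0 <= mxnorm p q W.
Proof. exact: lnorm_ge0. Qed.

Lemma mxnorm_row n (W : 'M[R]_(1, n)) : mxnorm p q W = lnorm p (W 0).
Proof. by rewrite /mxnorm lnorm1// ger0_norm ?lnorm_ge0. Qed.

Lemma mxnormZ m n (c : R) (W : 'M[R]_(m, n)) : 0 <= c ->
  mxnorm p q (c *: W) = c * mxnorm p q W.
Proof.
move=> c0; rewrite /mxnorm -lnormZ//; congr (lnorm q _); apply/funext => i.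
by rewrite -lnormZ//; congr (lnorm p _); apply/funext => j; rewrite mxE.
Qed.

Lemma mxnorm0 m n : mxnorm p q (0 : 'M[R]_(m, n)) = 0.
Proof.
by rewrite -(scale0r (0 : 'M[R]_(m, n))) mxnormZ// mul0r.
Qed.

Lemma ler_norm_mxnorm m n (W : 'M[R]_(m, n)) i j : `|W i j| <= mxnorm p q W.
Proof.
apply: (le_trans (ler_norm_lnorm p _ (W i) j p1)).
rewrite -[leLHS]ger0_norm ?lnorm_ge0//.
exact: (ler_norm_lnorm q _ (fun i => lnorm p (W i)) i q1).
Qed.

(** A matrix of norm zero vanishes, its entries being dominated by the norm, so the factorisation
    also holds without dividing. *)
Lemma mxnorm_normalize m n (W : 'M[R]_(m, n)) :
  exists2 W', mxnorm p q W' <= 1 & W = mxnorm p q W *: W'.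
Proof.
have [W0|W0] := eqVneq (mxnorm p q W) 0.
  exists 0; first by rewrite mxnorm0.
  rewrite W0 scale0r; apply/matrixP => i j; rewrite mxE; apply/eqP.
  by rewrite -normr_le0 -W0 ler_norm_mxnorm.
exists ((mxnorm p q W)^-1 *: W); last by rewrite scalerA mulfV// scale1r.
by rewrite mxnormZ ?invr_ge0 ?mxnorm_ge0// mulVf.
Qed.

End MatrixNorm.

(** * Homogeneity of networks and removal of one layer *)

Section Networks.
Context {R : realType} (n H m : nat) (p : R) (q : \bar R).
Hypotheses (p1 : 1 <= p) (q1 : (1 <= q)%E).
Local Notation ps := (hoelder_conjugate p%:E).
Local Notation network := (network (R := R) n H).
Local Notation hidden := (hidden (R := R) n H).
Implicit Types (k d : nat) (x : 'cV[R]_n).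

Let p1e : (1 <= p%:E)%E. Proof. by rewrite lee_fin. Qed.

Let ps1 : (1 <= ps)%E. Proof. exact: hoelder_conj_ge1. Qed.

(** Norms at most 1, rather than equal to 1, admit zero layers. *)
Definition normalized d (w : network d) : bool :=
  all (fun r => r <= 1) (layer_norms p%:E q w).

Lemma netfunE d (w : network d) x :
  netfun w x = \sum_j w.2 0 j * activation w.1 x j 0.
Proof. by rewrite /netfun mxE. Qed.

Lemma size_layer_norms d (w : network d) : (0 < d)%N ->
  size (layer_norms p%:E q w) = d.
Proof.
move=> d0; rewrite /layer_norms size_rcons.
suff -> k (h : hidden k) : size (hidden_norms p%:E q h) = k by rewrite prednK.
by elim: k h => //= k IH h; rewrite size_rcons IH.
Qed.

Lemma layer_norms_ge0 d (w : network d) : all (fun r => 0 <= r) (layer_norms p%:E q w).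
Proof.
rewrite /layer_norms all_rcons mxnorm_ge0/=.
suff H0 k (h : hidden k) : all (fun r => 0 <= r) (hidden_norms p%:E q h) by [].
by elim: k h => //= k IH h; rewrite all_rcons mxnorm_ge0 IH.
Qed.

Lemma psi_wE d (w : network d) : (0 < d)%N ->
  psi_w p%:E q w = \prod_(r <- layer_norms p%:E q w) r.
Proof. by move=> d0; rewrite (big_nth 0) size_layer_norms// big_mkord. Qed.

Lemma psi_w_ge0 d (w : network d) : (0 < d)%N -> 0 <= psi_w p%:E q w.
Proof.
move=> d0; rewrite psi_wE// big_seq prodr_ge0// => r rw.
by have /allP := layer_norms_ge0 d w; apply.
Qed.

Lemma mu_w_ge0 d (w : network d) : 0 <= mu_w p%:E q w.
Proof. exact: lnorm_ge0. Qed.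

Lemma reluZ k (c : R) (v : 'cV[R]_k) : 0 <= c -> relu (c *: v) = c *: relu v.
Proof.
move=> c0; apply/matrixP => i j; rewrite !mxE.
by rewrite -[X in Num.max _ X](mulr0 c) maxr_pMr.
Qed.

(** As [relu] is positively homogeneous, the norm of each layer passes through all later ones. *)
Lemma activation_normalize k (h : hidden k) : exists2 h' : hidden k,
  all (fun r => r <= 1) (hidden_norms p%:E q h') &
  forall x, activation h x = (\prod_(r <- hidden_norms p%:E q h) r) *: activation h' x.
Proof.
elim: k h => [|k IH] h /=; first by exists tt => // x; rewrite big_nil scale1r.
have [h' h'1 hE] := IH h.1.
have [W' W'1 WE] := mxnorm_normalize _ _ p1e q1 _ _ h.2.
exists (h', W'); first by rewrite all_rcons W'1.
move=> x; rewrite big_rcons/= hE {1}WE -scalemxAl -scalemxAr scalerA.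
rewrite reluZ; first by rewrite [X in X *: _]mulrC.
apply: mulr_ge0; first exact: mxnorm_ge0.
rewrite big_seq prodr_ge0// => r rh.
have := layer_norms_ge0 k.+1 (h.1, 0); rewrite /layer_norms all_rcons => /andP[_ /allP].
exact.
Qed.

Lemma netfun_normalize d (w : network d) : (0 < d)%N -> exists2 w' : network d,
  normalized d w' & forall x, netfun w x = psi_w p%:E q w * netfun w' x.
Proof.
move=> d0; have [h' h'1 hE] := activation_normalize _ w.1.
have [W' W'1 WE] := mxnorm_normalize _ _ p1e q1 _ _ w.2.
exists (h', W'); first by rewrite /normalized /layer_norms all_rcons W'1.
move=> x; rewrite psi_wE// /netfun hE {1}WE -scalemxAl -scalemxAr scalerA mxE.
by rewrite /layer_norms big_rcons [X in X * _ = _]mulrC.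
Qed.

(** Provides the zero point for the contraction principle and an inhabitant of the normalised
    class. *)
Lemma zero_network d : (0 < d)%N -> exists w : network d,
  [/\ normalized d w, netfun w = (fun=> 0) & psi_w p%:E q w = 0].
Proof.
move=> d0; have [h0 h01] : exists h : hidden d.-1,
    all (fun r => r <= 1) (hidden_norms p%:E q h).
  elim: d.-1 => [|k [h h1]]; first by exists tt.
  by exists (h, 0); rewrite /= all_rcons mxnorm0// ler01.
exists (h0, 0); split.
- by rewrite /normalized /layer_norms all_rcons mxnorm0// ler01.
- by apply/funext => x; rewrite /netfun mul0mx mxE.
- by rewrite psi_wE// /layer_norms big_rcons mxnorm0//= mulr0.
Qed.

(* Hoelder on the output row, then positive homogeneity of [relu]: the network is
   dominated by a single hidden unit of the last hidden layer, rescaled to have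
   an incoming weight vector of norm at most 1. *)
Lemma peel_layer k (w : network k.+2) (xi : {ffun 'I_m -> bool})
    (x : 'I_m -> 'cV[R]_n) : (0 < H)%N -> normalized k.+2 w ->
  exists2 w' : network k.+1, normalized k.+1 w' &
    `|rsum xi (fun i => netfun w (x i))| <=
    H%:R `^ Num.max (rinv ps - rinv q) 0 *
      `|rsum xi (fun i => Num.max (netfun w' (x i)) 0)|.
Proof.
move=> H0; case: w => [[h V] W].
rewrite /normalized /layer_norms /= !all_rcons /= => /and3P[W1 V1 h1].
pose r (j : 'I_H) := lnorm p%:E (V j).
(* Unit [j] of the last hidden layer becomes the output of a network one layer shallower; if
   [r j = 0], the convention [0^-1 = 0] gives it a zero output row. *)
pose u (j : 'I_H) : network k.+1 := (h, \row_l ((r j)^-1 * V j l)).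
pose F (j : 'I_H) := rsum xi (fun i => Num.max (netfun (u j) (x i)) 0).
have r0 j : 0 <= r j by exact: lnorm_ge0.
have u1 j : normalized k.+1 (u j).
  rewrite /normalized /layer_norms all_rcons /= h1 andbT mxnorm_row//.
  have -> : lnorm p%:E ((\row_l ((r j)^-1 * V j l)) 0) = (r j)^-1 * r j.
    have ir0 : 0 <= (r j)^-1 by rewrite invr_ge0.
    rewrite -(lnormZ _ _ _ _ p1e ir0); congr (lnorm _ _); apply/funext => l.
    by rewrite mxE.
  by have [->|?] := eqVneq (r j) 0; rewrite ?mulr0 ?mulVf.
have act i j : activation ((h, V) : hidden k.+1) (x i) j 0 =
    r j * Num.max (netfun (u j) (x i)) 0.
  rewrite /= !mxE (maxr_pMr _ _ (r0 j)) mulr0 netfunE mulr_sumr; congr Num.max.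
  apply: eq_bigr => l _; rewrite mxE mulrA; congr (_ * _).
  have [rj0|rj0] := eqVneq (r j) 0; last by rewrite mulrA mulfV// mul1r.
  rewrite rj0 mul0r; apply/eqP; rewrite -normr_le0 -rj0.
  exact: (ler_norm_lnorm _ _ (V j) l p1e).
have sumE : rsum xi (fun i => netfun ((h, V, W) : network k.+2) (x i)) =
    \sum_j W 0 j * (F j * r j).
  rewrite /rsum; under eq_bigr do rewrite netfunE mulr_sumr.
  rewrite exchange_big/=; apply: eq_bigr => j _.
  rewrite /F /rsum mulr_suml mulr_sumr; apply: eq_bigr => i _.
  by rewrite act; ring.
have [j0 j0P] := exists_maximum _ (fun j => `|F j|) (Ordinal H0).
exists (u j0); first exact: u1.
rewrite [X in `|X| <= _]sumE.
apply: le_trans (hoelder_sum _ _ _ _ p1 _) _; first by rewrite -(mxnorm_row _ q).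
apply: (@le_trans _ _ (lnorm ps (fun j => `|F j0| * r j))).
  by apply: le_lnorm => // j; rewrite !normrM normr_id ler_wpM2r.
rewrite lnormZ// mulrC ler_wpM2r//.
(* The [q]-norm of the row norms [r] is the norm of [V], which is at most 1. *)
exact: lnorm_compare.
Qed.

End Networks.

(** * Rademacher sums over the network classes *)

Section NetworkClasses.
Context {R : realType} (n H m : nat) (p : R) (q : \bar R).
Hypotheses (p1 : 1 <= p) (q1 : (1 <= q)%E).
Variable x : 'I_m -> 'cV[R]_n.
Local Notation ps := (hoelder_conjugate p%:E).
Local Notation network := (network (R := R) n H).
Local Notation c := (2 * H%:R `^ Num.max (rinv ps - rinv q) 0 : R).
Local Notation signs := {ffun 'I_m -> bool}.

Let p1e : (1 <= p%:E)%E. Proof. by rewrite lee_fin. Qed.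

Lemma relu_lipschitz (a b : R) : `|Num.max a 0 - Num.max b 0| <= `|a - b|.
Proof.
case: (leP a 0) => a0; case: (leP b 0) => b0 //.
- by rewrite subrr normr0.
- by rewrite sub0r normrN [leRHS]distrC !ger0_norm; lra.
- by rewrite subr0 !ger0_norm; lra.
Qed.

(** Induction on the number of hidden layers: peeling costs the power of [H], contraction costs the
    2. With no hidden layer the output row is a linear functional of norm at most 1. *)
Lemma normalized_bound (M : R) k (w : signs -> network k.+1) :
  (forall v : signs -> 'cV[R]_n, (forall xi, vnorm p%:E (v xi) <= 1) ->
    \sum_xi `|rsum xi (fun i => \sum_j v xi j 0 * x i j 0)| <= M) ->
  (forall xi, normalized n H p q k.+1 (w xi)) ->
  \sum_xi `|rsum xi (fun i => netfun (w xi) (x i))| <= c ^+ k * M.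
Proof.
move=> linM; have c0 : 0 <= c by rewrite mulr_ge0 ?powR_ge0.
have M0 : 0 <= M.
  apply: le_trans (linM (fun=> 0) _); first by rewrite sumr_ge0.
  move=> xi; rewrite /vnorm (_ : (fun _ => _) = fun=> 0) ?lnorm0//.
  by apply/funext => j; rewrite mxE.
elim: k w => [|k IH] w w1.
  rewrite expr0 mul1r; apply: le_trans (linM (fun xi => (w xi).2^T) _).
    apply: ler_sum => xi _; rewrite le_eqVlt; apply/orP; left; apply/eqP.
    congr `|_|; apply: eq_bigr => i _; rewrite netfunE; congr (_ * _).
    by apply: eq_bigr => j _; rewrite mxE.
  move=> xi; have := w1 xi; rewrite /normalized /layer_norms all_rcons => /andP[+ _].
  rewrite (mxnorm_row _ q q1) => W1.
  have -> : vnorm p%:E (w xi).2^T = lnorm p%:E ((w xi).2 0).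
    by congr (lnorm _ _); apply/funext => j; rewrite mxE.
  exact: W1.
(* At width zero the network is the zero function; the case is split off because peeling selects a
   unit. *)
have [H0|H0] := posnP H.
  rewrite big1 => [|xi _]; first by rewrite mulr_ge0// exprn_ge0.
  rewrite /rsum big1 ?normr0// => i _; rewrite netfunE big1 ?mulr0// => j _.
  by have := ltn_ord j; rewrite [X in (_ < X)%N]H0.
have /choice[w' w'P] xi : exists w' : network k.+1, normalized n H p q k.+1 w' /\
    `|rsum xi (fun i => netfun (w xi) (x i))| <=
    H%:R `^ Num.max (rinv ps - rinv q) 0 *
      `|rsum xi (fun i => Num.max (netfun w' (x i)) 0)|.
  by have [w' ? ?] := peel_layer _ _ _ _ _ p1 q1 _ _ xi x H0 (w1 xi); exists w'.
apply: (@le_trans _ _ (\sum_xi H%:R `^ Num.max (rinv ps - rinv q) 0 *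
    `|rsum xi (fun i => Num.max (netfun (w' xi) (x i)) 0)|)).
  by apply: ler_sum => xi _; exact: (w'P xi).2.
have -> : c ^+ k.+1 * M =
    H%:R `^ Num.max (rinv ps - rinv q) 0 * (2 * (c ^+ k * M)).
  by rewrite exprS; ring.
rewrite -mulr_sumr; apply: ler_wpM2l; first exact: powR_ge0.
(* Contraction acts on the vectors of values that shallower normalised networks take on the
   sample. *)
pose T := [set t : 'I_m -> R | exists2 v : network k.+1,
  normalized n H p q k.+1 v & t = fun i => netfun v (x i)].
refine (rademacher_contraction T (fun z => Num.max z 0) (c ^+ k * M)
  (fun xi i => netfun (w' xi) (x i)) _ _ _ _ _).
- exact: relu_lipschitz.
- exact: maxxx.
- have [v [v1 v0 _]] := zero_network n H p q p1 q1 k.+1 isT.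
  by exists v => //; rewrite v0.
- move=> s Ts.
  have /choice[v vP] xi : exists v : network k.+1, normalized n H p q k.+1 v /\
      s xi = fun i => netfun v (x i).
    by have [v ? ?] := Ts xi; exists v.
  apply: le_trans (IH v _); last by move=> xi; exact: (vP xi).1.
  by apply: ler_sum => xi _; rewrite (vP xi).2.
- by move=> xi; exists (w' xi) => //; exact: (w'P xi).1.
Qed.

(** Lets the slack [e] tend to 0; the slack arises because networks are chosen only within [e] of
    the infimum [psi_f]. *)
Lemma mul_ler_addgt0 (a b K X : R) : 0 <= K ->
  (forall e, 0 < e -> X <= (a + e) * K) -> X <= a * K.
Proof.
move=> K0 h; apply/ler_addgt0Pr => e e0.
have d0 : 0 < e / (K + 1) by rewrite divr_gt0// ltr_wpDl.
apply: le_trans (h _ d0) _; rewrite mulrDl lerD2l mulrAC ler_pdivrMr ?ltr_wpDl//.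
by rewrite ler_wpM2l ?(ltW e0)// lerDl.
Qed.

Lemma netclass_psi_bound (M psi : R) k (f : signs -> 'cV[R]_n -> R) :
  (forall v : signs -> 'cV[R]_n, (forall xi, vnorm p%:E (v xi) <= 1) ->
    \sum_xi `|rsum xi (fun i => \sum_j v xi j 0 * x i j 0)| <= M) ->
  (forall xi, netclass_psi H p%:E q k.+1 psi (f xi)) ->
  \sum_xi `|rsum xi (fun i => f xi (x i))| <= psi * (c ^+ k * M).
Proof.
move=> linM fpsi.
have /choice[u uP] (xi : signs) : exists u : network k.+1, normalized n H p q k.+1 u.
  by have [u [u1 _ _]] := zero_network n H p q p1 q1 k.+1 isT; exists u.
have K0 : 0 <= c ^+ k * M.
  by apply: le_trans (normalized_bound _ _ u linM uP); apply: sumr_ge0.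
apply: mul_ler_addgt0 => // e e0.
have /choice[w wP] xi : exists w : network k.+1,
    netfun w = f xi /\ psi_w p%:E q w <= psi + e.
  have [[w0 w0f] fxi] := fpsi xi.
  have /(inf_adherent e0)[_ [w /= wf <-] we] : has_inf
      [set psi_w p%:E q w | w in [set w : network k.+1 | netfun w = f xi]].
    split; first by exists (psi_w p%:E q w0); exists w0.
    by exists 0 => _ [w _ <-]; exact: psi_w_ge0.
  exists w; split=> //; apply: ltW; apply: lt_le_trans we _.
  by rewrite lerD2r.
have /choice[w' w'P] xi : exists w' : network k.+1, normalized n H p q k.+1 w' /\
    forall y, netfun (w xi) y = psi_w p%:E q (w xi) * netfun w' y.
  by have [w' ? ?] := netfun_normalize n H p q p1 q1 k.+1 (w xi) isT; exists w'.
apply: (@le_trans _ _ (\sum_xi (psi + e) * `|rsum xi (fun i => netfun (w' xi) (x i))|)).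
  apply: ler_sum => xi _; rewrite -(wP xi).1.
  have -> : rsum xi (fun i => netfun (w xi) (x i)) =
      psi_w p%:E q (w xi) * rsum xi (fun i => netfun (w' xi) (x i)).
    by rewrite -rsumZ; congr rsum; apply/funext => i; exact: (w'P xi).2.
  rewrite normrM; apply: ler_wpM2r => //.
  by rewrite ger0_norm ?psi_w_ge0//; exact: (wP xi).2.
rewrite -mulr_sumr; apply: ler_wpM2l.
  (* The sign of [psi + e] is read off the network chosen for one arbitrary sign vector. *)
  have := (wP (finfun (fun=> true))).2; apply: le_trans; exact: psi_w_ge0.
exact: (normalized_bound M k w' linM (fun xi => (w'P xi).1)).
Qed.

(** AM-GM bounds the product of the layer norms by a power of their mean; comparing the 1-norm with
    the [q]-norm bounds that mean. *)
Lemma psi_w_le_mu_w k (w : network k.+1) :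
  psi_w p%:E q w <= (mu_w p%:E q w / k.+1%:R `^ rinv q) ^+ k.+1.
Proof.
pose u (i : 'I_k.+1) := (layer_norms p%:E q w)`_i.
have u0 i : 0 <= u i.
  have /allP := layer_norms_ge0 n H p q k.+1 w; apply.
  by apply: mem_nth; rewrite size_layer_norms.
rewrite /psi_w /mu_w -/u; set T := lnorm q u.
have T0 : 0 <= T := lnorm_ge0 _ _ _.
have d0 : 0 < k.+1%:R :> R by rewrite ltr0n.
have sumT : \sum_i u i <= k.+1%:R `^ (1 - rinv q) * T.
  have [TE|Tn] := eqVneq T 0.
    rewrite TE mulr0 big1// => i _; apply/eqP; rewrite eq_le u0 andbT -TE.
    by rewrite -[leLHS]ger0_norm//; exact: (ler_norm_lnorm q _ u i q1).
  have Tp : 0 < T by rewrite lt0r Tn.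
  have i0 : 0 <= T^-1 by rewrite invr_ge0.
  have := lnorm_compare 1%:E q k.+1 (fun i => T^-1 * u i) (lexx _) q1.
  rewrite (lnormZ q _ _ u q1 i0) mulVf// => /(_ (lexx _)).
  rewrite (lnormZ _ _ _ u (lexx _) i0) ler_pdivrMl// mulrC.
  have -> : Num.max (rinv 1%:E - rinv q) 0 = 1 - rinv q.
    rewrite /rinv inve1/= max_l// subr_ge0.
    case: q q1 => [r| |] r1; [|by rewrite invey|by []].
    rewrite lee_fin in r1; rewrite inver gt_eqF/= ?invf_le1//; lra.
  have -> // : lnorm 1%:E u = \sum_i u i.
  rewrite /lnorm invr1 powRr1; last by apply: sumr_ge0 => i _; exact: powR_ge0.
  by apply: eq_bigr => i _; rewrite powRr1// ger0_norm.
have := (leif_AGM (A := xpredT) (E := u) (fun i _ => u0 i)).1.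
rewrite card_ord => /le_trans; apply.
have h0 : 0 <= (\sum_i u i) / k.+1%:R by rewrite divr_ge0// sumr_ge0.
apply: lerXn2r; rewrite ?nnegrE//.
  by rewrite divr_ge0// powR_ge0.
rewrite ler_pdivrMr//; apply: le_trans sumT _.
rewrite powRB ?pnatr_eq0 ?implybT// powRr1 ?(ltW d0)//.
by rewrite le_eqVlt; apply/orP; left; apply/eqP; ring.
Qed.

Lemma netclass_mu_sub_psi k (mu : R) : 0 <= mu ->
  netclass_mu H p%:E q k.+1 mu `<=`
  netclass_psi (n := n) H p%:E q k.+1 (mu ^+ k.+1 / (k.+1%:R `^ rinv q) ^+ k).
Proof.
move=> mu0 f [[w0 w0f] fmu]; split; first by exists w0.
set D := k.+1%:R `^ rinv q.
have D1 : 1 <= D.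
  have k1 : 1 <= k.+1%:R :> R by rewrite ler1n.
  rewrite /D -[leLHS](powRr0 k.+1%:R); apply: (ler_powR k1).
  rewrite /rinv; case: q q1 => [r| |] r1; [|by rewrite invey|by []].
  rewrite lee_fin in r1; rewrite inver gt_eqF/= ?invr_ge0//; lra.
have Dp : 0 < D by lra.
have psi0 : 0 <= psi_f H p%:E q k.+1 f.
  apply: lb_le_inf; first by exists (psi_w p%:E q w0); exists w0.
  by move=> _ [w _ <-]; exact: psi_w_ge0.
have key e : 0 < e -> psi_f H p%:E q k.+1 f <= ((mu + e) / D) ^+ k.+1.
  move=> e0.
  have /(inf_adherent e0)[_ [w /= wf <-] we] : has_inf
      [set mu_w p%:E q w | w in [set w : network k.+1 | netfun w = f]].
    split; first by exists (mu_w p%:E q w0); exists w0.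
    by exists 0 => _ [w _ <-]; exact: mu_w_ge0.
  apply: (@le_trans _ _ (psi_w p%:E q w)).
    apply: ge_inf; last by exists w.
    by exists 0 => _ [v _ <-]; exact: psi_w_ge0.
  apply: le_trans (psi_w_le_mu_w _ _) _; apply: lerXn2r.
  - by rewrite nnegrE divr_ge0 ?mu_w_ge0// ltW.
  - by rewrite nnegrE divr_ge0 ?(ltW Dp)// addr_ge0// ltW.
  rewrite ler_pM2r ?invr_gt0//; apply: ltW; apply: lt_le_trans we _.
  by rewrite lerD2r.
(* AM-GM yields the denominator [D ^ k.+1]; since [D >= 1] it is weakened to the exponent [k], one
   less than the depth. *)
apply: (@le_trans _ _ ((mu / D) ^+ k.+1)); last first.
  rewrite expr_div_n ler_wpM2l ?exprn_ge0// lef_pV2 ?posrE ?exprn_gt0//.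
  by rewrite exprS ler_peMl// exprn_ge0// ltW.
set X := psi_f _ _ _ _ _ in psi0 key *.
(* Passing to the root of order [k.+1] makes the bound linear in [e], so that [e] can tend to 0. *)
pose y := X `^ (k.+1%:R)^-1.
have y0 : 0 <= y by exact: powR_ge0.
have yX : y ^+ k.+1 = X.
  by rewrite -powR_mulrn// -powRrM mulVf ?pnatr_eq0// powRr1.
rewrite -yX; apply: lerXn2r; rewrite ?nnegrE//; first by rewrite divr_ge0// ltW.
rewrite ler_pdivlMr//; apply/ler_addgt0Pr => e e0.
have h0 : 0 <= (mu + e) / D by rewrite divr_ge0 ?(ltW Dp)// addr_ge0// ltW.
by have := key e e0; rewrite -yX ler_pXn2r// ler_pdivlMr.
Qed.

End NetworkClasses.

(** * Rademacher complexity expressed by selectors *)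

Section Rademacher.
Context {R : realType} (n m : nat) (x : 'I_m -> 'cV[R]_n).
Local Notation signs := {ffun 'I_m -> bool}.
Implicit Types F : set ('cV[R]_n -> R).

(** Near-maximal choices, each within [d] of its supremum, lose at most [e] in total. *)
Lemma sup_selector (I : finType) (A : I -> set R) (K : R) :
  (forall i, A i !=set0) -> (forall i, A i `<=` [set t | 0 <= t]) ->
  (forall a : I -> R, (forall i, A i (a i)) -> \sum_i a i <= K) ->
  exists2 s : I -> R, (forall i, ereal_sup [set t%:E | t in A i] = (s i)%:E) &
    \sum_i s i <= K.
Proof.
move=> A0 Age0 AK; have /choice[a0 a0P] : forall i, exists t, A i t by [].
have Aub i : has_ubound (A i).
  (* Only the choice at [i] varies; the other terms are nonnegative, so [K] bounds every element of
     [A i]. *)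
  exists K => t At; pose a j := if j == i then t else a0 j.
  have aA j : A j (a j) by rewrite /a; case: eqP => [->|].
  apply: le_trans (AK a aA); rewrite (bigD1 i)//= {1}/a eqxx lerDl sumr_ge0// => j _.
  exact: Age0 (aA j).
exists (fun i => sup (A i)) => [i|]; first exact: ereal_sup_EFin.
apply/ler_addgt0Pr => e e0.
pose d := e / (#|I|%:R + 1); have d0 : 0 < d by rewrite divr_gt0// ltr_wpDl.
have /choice[a aP] i : exists t, A i t /\ sup (A i) - d < t.
  by have [t At ?] := sup_adherent d0 (conj (A0 i) (Aub i)); exists t.
apply: (@le_trans _ _ (\sum_i (a i + d))).
  by apply: ler_sum => i _; rewrite -lerBlDr ltW//; exact: (aP i).2.
rewrite big_split/= lerD//; first by apply: AK => i; exact: (aP i).1.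
rewrite sumr_const -[_ *+ _]mulr_natr /d mulrAC ler_pdivrMr ?ltr_wpDl//.
by rewrite ler_wpM2l ?(ltW e0)// lerDl.
Qed.

Lemma rademacher_mono F G : F `<=` G -> (rademacher x F <= rademacher x G)%E.
Proof.
move=> FG; rewrite /rademacher; apply: lee_wpmul2l; first by rewrite lee_fin invr_ge0.
apply: lee_sum => xi _; apply: lee_wpmul2l; first by rewrite lee_fin invr_ge0.
by apply: ereal_sup_le; exact: image_subset.
Qed.

Lemma rademacher_le F (K : R) : (0 < m)%N -> 0 <= K ->
  (forall f : signs -> 'cV[R]_n -> R, (forall xi, F (f xi)) ->
    \sum_xi `|rsum xi (fun i => f xi (x i))| <= K) ->
  (rademacher x F <= (K / (2 ^+ m * m%:R))%:E)%E.
Proof.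
move=> m0 K0; wlog [f0 Ff0] : F / F !=set0.
  (* The suprema over an empty class are [-oo]; such a class is compared with the one containing
     only the zero function. *)
  move=> h FK; have [F0|/set0P F0] := eqVneq F set0; last exact: h.
  apply: (@le_trans _ _ (rademacher x [set fun=> 0])).
    by apply: rademacher_mono; rewrite F0.
  apply: h => [|f f0]; first by exists (fun=> 0).
  apply: le_trans K0; rewrite big1// => xi _.
  by rewrite (f0 xi) /rsum big1 ?normr0// => i _; rewrite mulr0.
move=> FK.
have [||f|s sE sK] := @sup_selector _
    (fun xi : signs => [set `|rsum xi (fun i => f (x i))| | f in F]) K.
- by move=> xi; exists (`|rsum xi (fun i => f0 (x i))|); exists f0.
- by move=> xi _ [f _ <-]; exact: normr_ge0.
- move=> fF; have /choice[g gP] xi : exists g, F g /\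
      `|rsum xi (fun i => g (x i))| = f xi.
    by have [g ? ?] := fF xi; exists g.
  apply: le_trans (FK g _); last by move=> xi; exact: (gP xi).1.
  by apply: ler_sum => xi _; rewrite (gP xi).2.
have -> : rademacher x F = ((2 ^ m)%:R^-1 * \sum_xi (m%:R^-1 * s xi))%:E.
  rewrite /rademacher EFinM -sumEFin; congr (_ * _)%E; apply: eq_bigr => xi _.
  rewrite EFinM -sE; congr (_ * ereal_sup _)%E.
  by rewrite image_comp.
rewrite lee_fin -mulr_sumr natrX invfM mulrA [leRHS]mulrC.
by rewrite ler_wpM2l// mulr_ge0 ?invr_ge0 ?exprn_ge0.
Qed.

(** For the linear class this turns the complexity into a bound for vectors that depend on the
    signs. *)
Lemma rademacher_ge F (f : signs -> 'cV[R]_n -> R) : (0 < m)%N ->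
  (forall xi, F (f xi)) ->
  (((\sum_xi `|rsum xi (fun i => f xi (x i))|) / (2 ^+ m * m%:R))%:E <=
    rademacher x F)%E.
Proof.
move=> m0 Ff; rewrite invfM mulrA mulrAC mulrC -natrX EFinM /rademacher.
apply: lee_wpmul2l; first by rewrite lee_fin invr_ge0.
rewrite mulr_suml -sumEFin; apply: lee_sum => xi _; rewrite mulrC EFinM.
apply: lee_wpmul2l; first by rewrite lee_fin invr_ge0.
by apply: ereal_sup_ubound; exists (f xi).
Qed.

(* [rho] is the linear complexity, which Hoelder's inequality shows to be finite. *)
Lemma rademacher_linearE (p : R) : 1 <= p -> (0 < m)%N -> exists rho : R,
  [/\ rademacher_linear p%:E x = rho%:E, 0 <= rho,
      rho <= (\sum_xi lnorm (hoelder_conjugate p%:E)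
                (fun j => rsum xi (fun i => x i j 0))) / (2 ^+ m * m%:R) &
      forall v : signs -> 'cV[R]_n, (forall xi, vnorm p%:E (v xi) <= 1) ->
        \sum_xi `|rsum xi (fun i => \sum_j v xi j 0 * x i j 0)| <=
        rho * (2 ^+ m * m%:R)].
Proof.
move=> p1 m0; have N0 : 0 < 2 ^+ m * m%:R :> R by rewrite mulr_gt0 ?exprn_gt0 ?ltr0n.
have ub : (rademacher_linear p%:E x <= ((\sum_xi lnorm (hoelder_conjugate p%:E)
                (fun j => rsum xi (fun i => x i j 0))) / (2 ^+ m * m%:R))%:E)%E.
  apply: rademacher_le => //; first by apply: sumr_ge0 => xi _; exact: lnorm_ge0.
  move=> f fF; apply: ler_sum => xi _; have [v /= v1 <-] := fF xi.
  have -> : rsum xi (fun i => \sum_j v j 0 * x i j 0) =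
      \sum_j v j 0 * rsum xi (fun i => x i j 0).
    rewrite /rsum; under eq_bigr do rewrite mulr_sumr.
    rewrite exchange_big/=; apply: eq_bigr => j _; rewrite mulr_sumr.
    by apply: eq_bigr => i _; rewrite mulrCA.
  exact: hoelder_sum.
have lb (v : signs -> 'cV[R]_n) : (forall xi, vnorm p%:E (v xi) <= 1) ->
    (((\sum_xi `|rsum xi (fun i => \sum_j v xi j 0 * x i j 0)|) /
      (2 ^+ m * m%:R))%:E <= rademacher_linear p%:E x)%E.
  move=> v1; apply: (rademacher_ge _ (fun xi y => \sum_j v xi j 0 * y j 0)) => // xi.
  by exists (v xi); [exact: v1|].
have v0 : vnorm p%:E (0 : 'cV[R]_n) <= 1.
  rewrite /vnorm (_ : (fun _ => _) = fun=> 0) ?lnorm0//.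
  by apply/funext => j; rewrite mxE.
have ge0 : (0 <= rademacher_linear p%:E x)%E.
  apply: le_trans (lb (fun=> 0) (fun=> v0)); rewrite lee_fin divr_ge0 ?(ltW N0)//.
  exact: sumr_ge0.
case: rademacher_linear ub lb ge0 => [rho| |]//= ub lb ge0.
exists rho; split=> // v v1; rewrite -ler_pdivrMr// -lee_fin; exact: lb.
Qed.

End Rademacher.

(** * The linear class for [p <= 2], and the four inequalities *)

Lemma hoelder_conjugate_ge2 (R : realType) (p : R) : 1 <= p -> p <= 2 ->
  (2%:E <= hoelder_conjugate p%:E)%E.
Proof.
move=> p1 p2; have [->|pn1] := eqVneq p 1; first by rewrite hoelder_conjugate1 leey.
have [|s [-> _ _ s2]] := hoelder_conjugate_fin p; first by rewrite lt_neqAle eq_sym pn1.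
by rewrite lee_fin s2.
Qed.

Lemma linear_rademacher_sum (R : realType) (n m : nat) (p : R) (x : 'I_m -> 'cV[R]_n) :
  (0 < n)%N -> (0 < m)%N -> 1 <= p -> p <= 2 ->
  \sum_xi lnorm (hoelder_conjugate p%:E) (fun j => rsum xi (fun i => x i j 0)) <=
  2 ^+ m * Num.sqrt (fine (Order.min (hoelder_conjugate p%:E) (4 * ln (2 * n%:R))%:E) *
    (m%:R * \big[Num.max/0]_(i < m) (vnorm (hoelder_conjugate p%:E) (x i) ^+ 2))).
Proof.
move=> n0 m0 p1 p2; set Q := \big[_/_]_(_ < m) _.
apply: (rademacher_lnorm _ n m (fun j i => x i j 0) Q n0 m0).
- exact: hoelder_conjugate_ge2.
- by rewrite /Q; elim/big_ind: _ => // [a b a0 _|i _]; rewrite ?le_max ?a0// sqr_ge0.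
- by move=> i; rewrite /Q (bigD1 i)//= le_max lexx.
Qed.

Theorem theorem3 (R : realType) (n m d H : nat) (p : R) (q : \bar R)
    (psi mu : R) (x : 'I_m -> 'cV[R]_n)
    (hn : (0 < n)%N) (hm : (0 < m)%N) (hd : (0 < d)%N)
    (hp : 1 <= p) (hq : (1%:E <= q)%E) (hpsi : 0 <= psi) (hmu : 0 <= mu) :
  let ps := hoelder_conjugate p%:E in
  let c := 2 * H%:R `^ Num.max (rinv ps - rinv q) 0 in
  let droot := d%:R `^ rinv q in
  let Rlin := rademacher_linear p%:E x in
  let B := fine (Order.min ps (4 * ln (2 * n%:R))%:E) *
           \big[Num.max/0]_(i < m) (vnorm ps (x i) ^+ 2) in
  [/\ (rademacher x (netclass_psi H p%:E q d psi)
         <= (psi * c ^+ d.-1)%:E * Rlin)%E,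
      (p <= 2 ->
       ((psi * c ^+ d.-1)%:E * Rlin
          <= (Num.sqrt (psi ^+ 2 * c ^+ (2 * d.-1) * B / m%:R))%:E)%E),
      (rademacher x (netclass_mu H p%:E q d mu)
         <= (mu ^+ d * (c / droot) ^+ d.-1)%:E * Rlin)%E
    & (p <= 2 ->
       ((mu ^+ d * (c / droot) ^+ d.-1)%:E * Rlin
          <= (Num.sqrt (mu ^+ (2 * d) * (c / droot) ^+ (2 * d.-1) * B
                        / m%:R))%:E)%E)].
Proof.
case: d hd => // k _ ps c droot Rlin B /=.
have [rho [rhoE rho0 rhoU rhoL]] := rademacher_linearE n m x p hp hm.
have mp : 0 < m%:R :> R by rewrite ltr0n.
have N0 : 0 < 2 ^+ m * m%:R :> R by rewrite mulr_gt0 ?exprn_gt0.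
have c0 : 0 <= c by rewrite mulr_ge0 ?powR_ge0.
(* The level [a] is arbitrary so as to cover both [psi] and the level [mu ^ d / droot ^ (d - 1)] of
   the class containing the [mu] class. *)
have bound_psi (a : R) : 0 <= a ->
    (rademacher x (netclass_psi H p%:E q k.+1 a) <= (a * c ^+ k)%:E * Rlin)%E.
  move=> a0; rewrite /Rlin rhoE -EFinM.
  have -> : a * c ^+ k * rho =
      a * (c ^+ k * (rho * (2 ^+ m * m%:R))) / (2 ^+ m * m%:R).
    by rewrite (mulrA a) (mulrA (a * _)) mulfK ?gt_eqF.
  apply: rademacher_le => //.
    by rewrite mulr_ge0// mulr_ge0 ?exprn_ge0// mulr_ge0// ltW.
  move=> f fF; exact: netclass_psi_bound.
have bound_lin (a : R) : 0 <= a -> p <= 2 ->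
    (a%:E * Rlin <= (Num.sqrt (a ^+ 2 * B / m%:R))%:E)%E.
  move=> a0 p2; rewrite /Rlin rhoE -EFinM lee_fin.
  have := linear_rademacher_sum _ _ _ p x hn hm hp p2.
  rewrite -/ps /B; set C := fine _; set Q := \big[_/_]_(_ < m) _ => sumle.
  (* The factor [m] under the root comes from the [m] samples; the square of [a / m] is set aside to
     be extracted. *)
  have -> : a ^+ 2 * (C * Q) / m%:R = (a / m%:R) ^+ 2 * (C * (m%:R * Q)).
    by field; rewrite gt_eqF.
  rewrite sqrtrM ?sqr_ge0// sqrtr_sqr ger0_norm ?divr_ge0//.
  rewrite -mulrA; apply: ler_wpM2l => //; apply: le_trans rhoU _.
  rewrite (ler_pdivrMr _ _ N0) [leRHS]mulrC -mulrA mulVKf ?gt_eqF//.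
have droot0 : 0 <= droot by exact: powR_ge0.
clearbody c; split.
- exact: bound_psi.
- move=> p2; have := bound_lin (psi * c ^+ k) _ p2.
  by rewrite (@exprMn _ 2) -exprM mulnC; apply; rewrite mulr_ge0 ?exprn_ge0.
- apply: le_trans (rademacher_mono _ _ x _ _ (netclass_mu_sub_psi n H p q hq k mu hmu)) _.
  rewrite expr_div_n mulrA mulrAC.
  by apply: bound_psi; rewrite divr_ge0 ?exprn_ge0.
- move=> p2; have := bound_lin (mu ^+ k.+1 * (c / droot) ^+ k) _ p2.
  rewrite (@exprMn _ 2) -!exprM ![(_ * 2)%N]mulnC; apply.
  by rewrite mulr_ge0 ?exprn_ge0 ?divr_ge0.
Qed.
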